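(* Fix a mesh $\mathcal T_h$ (with $\mathbf F$ compact and $(\sigma,\lambda)\mapsto\sigma\lambda\sigma^T$ bijective from $\mathbf F$ onto $\mathbb S_1$). Then for every bounded $g:\partial\Omega\to\mathbb R$ there exists a unique $u_h\in V_h$ solving the discrete scheme $H_h(u_h(x_i),u_h)(x_i)=0$ for all $x_i\in\mathcal N_h$. Moreover, for any starting control $\mathbf B_0$, the sequence $(v^\ell)_\ell$ generated by Howard's algorithm converges to $u_h$ monotonically decreasingly and superlinearly as $\ell\to\infty$.
   Context: Standing setting: $d\ge2$, $\Omega\subset\mathbb R^d$ a bounded open strictly convex domain, $f:\Omega\to[0,\infty)$ bounded and continuous. $\mathbb S$: real symmetric $d\times d$ matrices; $\mathbb S_+$: positive semidefinite ones; $\mathbb S_1=\{B\in\mathbb S_+:\operatorname{tr}B=1\}$. Mesh: $\mathcal T_h$ is a shape-regular simplicial partition whose union $\Omega_h$ satisfies $\Omega_h\subset\Omega$; its nodes are $\mathcal N_h=\mathcal N_h^I\cup\mathcal N_h^B$, where the boundary nodes $\mathcal N_h^B$ (nodes on $\partial\Omega_h$) lie on $\partial\Omega$ and $\mathcal N_h^I$ are the interior nodes. $V_h$ is the space of continuous piecewise linear functions on $\mathcal T_h$; functions on $\Omega_h$ are extended to $\overline\Omega$ by being constant along the outer normal directions of $\partial\Omega_h$. $B(\overline\Omega)$ denotes the bounded real functions on $\overline\Omega$. Controls: $\mathbf F\subset\mathbb R^{d\times d}\times\{\text{diagonal }d\times d\text{ matrices}\}$ is compact, the map $(\sigma,\lambda)\mapsto\sigma\lambda\sigma^T$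 is a bijection from $\mathbf F$ onto $\mathbb S_1$, and every $\lambda$ occurring in $\mathbf F$ has nonnegative diagonal entries and the same trace $C>0$. For $B\in\mathbb S_1$, $(\sigma(B),\lambda(B))$ denotes its preimage; $\sigma_j$ is the $j$th column of $\sigma$ and $\lambda_j$ the $j$th diagonal entry of $\lambda$. Stencil size: $k=k(h,x)>0$ is such that $x\pm k(h,x)\sigma_j\in\overline\Omega_h$ for every $x\in\Omega_h$ and every column $\sigma_j$ of every $\sigma$ with $(\sigma,\lambda)\in\mathbf F$. Discrete Hamiltonian: for $B\in\mathbb S_1$, $s\in\mathbb R$, $\phi\in B(\overline\Omega)$, with $(\sigma,\lambda)=(\sigma(B),\lambda(B))$ and $k=k(h,x_i)$, set $L_h^B(s,\phi)(x_i)=-\sum_{j=1}^d\lambda_j\frac{\phi(x_i-k\sigma_j)-2s+\phi(x_i+k\sigma_j)}{k^2}+f(x_i)\sqrt[d]{\det B}$ for $x_i\in\mathcal N_h^I$, and $L_h^B(s,\phi)(x_i)=s-g(x_i)$ for $x_i\in\mathcal N_h^B$. Set $H_h(s,\phi)(x_i)=\sup_{B\in\mathbb S_1}L_h^B(s,\phi)(x_i)$ at nodes; $H_h(s,\phi)$ is extended to $\Omega_h$ by piecewise linear interpolation of the nodal values and to $\overline\Omega$ by constant extension along outer normals of $\partial\Omega_h$. Howard's algorithm: a control is $\mathbf B=(B_i)_{x_i\in\mathcal N_h^I}\in\mathbb S_1^{\mathcal N_h^I}$. With $(\sigma^{(i)},\lambda^{(i)})=(\sigma(B_i),\lambda(B_i))$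 define $\mathsf L_h^{\mathbf B}:V_h\to V_h$ and $\mathsf F_h^{\mathbf B}\in V_h$ by nodal values: $\mathsf L_h^{\mathbf B}(\phi)(x_i)=-\sum_{j}\lambda^{(i)}_j\frac{\phi(x_i-k\sigma^{(i)}_j)-2\phi(x_i)+\phi(x_i+k\sigma^{(i)}_j)}{k^2}$, $\mathsf F_h^{\mathbf B}(x_i)=f(x_i)\sqrt[d]{\det B_i}$ for $x_i\in\mathcal N_h^I$; $\mathsf L_h^{\mathbf B}(\phi)(x_i)=\phi(x_i)$, $\mathsf F_h^{\mathbf B}(x_i)=-g(x_i)$ for $x_i\in\mathcal N_h^B$. Starting from an arbitrary $\mathbf B_0$, for $\ell=0,1,2,\dots$: let $v^\ell\in V_h$ solve $\mathsf L_h^{\mathbf B_\ell}(v^\ell)(x_i)+\mathsf F_h^{\mathbf B_\ell}(x_i)=0$ for all $x_i\in\mathcal N_h$, and let $\mathbf B_{\ell+1}$ be a nodewise maximizer over $\mathbf B$ of $\mathsf L_h^{\mathbf B}(v^\ell)(x_i)+\mathsf F_h^{\mathbf B}(x_i)$. *)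

(* Defs.v *)
From HB Require Import structures.
From mathcomp Require Import all_boot perm.
From Stdlib Require Import Reals ClassicalEpsilon.
Set Implicit Arguments. Unset Strict Implicit.
Open Scope R_scope.

Definition Vec (d : nat) := 'I_d -> R.
Definition Mat (d : nat) := 'I_d -> 'I_d -> R.

Definition rsum (n : nat) (F : 'I_n -> R) : R := \big[Rplus/R0]_(i < n) F i.

Definition vnorm d (x : Vec d) : R := sqrt (rsum (fun i => x i * x i)).
Definition vdist d (x y : Vec d) : R := vnorm (fun i => x i - y i).

Definition trace d (B : Mat d) : R := rsum (fun i => B i i).
Definition detR d (A : Mat d) : R :=
  \big[Rplus/R0]_(s : {perm 'I_d})
     ((-1) ^ (odd_perm s) * \big[Rmult/R1]_(i < d) A i (s i)).

Definition symmetric d (B : Mat d) := forall i j, B i j = B j i.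
Definition psd d (B : Mat d) :=
  forall v : Vec d, 0 <= rsum (fun i => rsum (fun j => v i * B i j * v j)).
Definition S1 d (B : Mat d) := symmetric B /\ psd B /\ trace B = 1.

Definition rootd (d : nat) (x : R) : R :=
  if Rlt_dec 0 x then Rpower x (/ INR d) else 0.

Definition closureS d (S : Vec d -> Prop) (x : Vec d) :=
  forall r, 0 < r -> exists y, S y /\ vdist y x < r.
Definition interiorS d (S : Vec d -> Prop) (x : Vec d) :=
  exists r, 0 < r /\ forall y, vdist y x < r -> S y.
Definition boundaryS d (S : Vec d -> Prop) (x : Vec d) := closureS S x /\ ~ S x.

Definition is_open d (S : Vec d -> Prop) := forall x, S x -> interiorS S x.
Definition is_bounded d (S : Vec d -> Prop) := exists Mb, forall x, S x -> vnorm x <= Mb.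
Definition strictly_convex d (S : Vec d -> Prop) :=
  forall x y t, closureS S x -> closureS S y -> x <> y -> 0 < t < 1 ->
    S (fun i => (1 - t) * x i + t * y i).

(* ---------- the mesh ----------
   N nodes with positions pos : 'I_N -> R^d, M closed d-simplices, simplex t
   having vertices pos (tri t a), a : 'I_(d+1). *)
Section Mesh.
Variables (d N M : nat) (pos : 'I_N -> Vec d) (tri : 'I_M -> 'I_d.+1 -> 'I_N).

Definition bary (mu : 'I_d.+1 -> R) := (forall a, 0 <= mu a) /\ rsum mu = 1.
Definition comb (t : 'I_M) (mu : 'I_d.+1 -> R) : Vec d :=
  fun c => rsum (fun a => mu a * pos (tri t a) c).
Definition in_simplex (t : 'I_M) (y : Vec d) := exists mu, bary mu /\ y = comb t mu.

Definition Omh_bar (y : Vec d) := exists t, in_simplex t y.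
Definition Omh (y : Vec d) := interiorS Omh_bar y.

Definition interior_node (i : 'I_N) := Omh (pos i).

Definition mesh_ok (Om : Vec d -> Prop) :=
  (forall i j, pos i = pos j -> i = j) /\
  (forall i, exists t a, tri t a = i) /\
  (forall t (mu : 'I_d.+1 -> R), rsum mu = 0 ->
      (forall c, rsum (fun a => mu a * pos (tri t a) c) = 0) -> forall a, mu a = 0) /\
  (* conformity: the intersection of two simplices is their common face *)
  (forall t1 t2 y, in_simplex t1 y -> in_simplex t2 y ->
      exists mu, bary mu /\ y = comb t1 mu /\
        forall a, mu a <> 0 -> exists b, tri t2 b = tri t1 a) /\
  (forall y, Omh y -> Om y) /\
  (forall i, ~ interior_node i -> boundaryS Om (pos i)).

(* V_h: continuous piecewise linear functions (values off closure(Omega_h) are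
   immaterial; they are given by the constant normal extension). *)
Definition inVh (phi : Vec d -> R) :=
  forall t mu, bary mu -> phi (comb t mu) = rsum (fun a => mu a * phi (pos (tri t a))).

Definition nodenorm (w : Vec d -> R) : R :=
  \big[Rmax/R0]_(i < N) Rabs (w (pos i)).
End Mesh.

(* sigma lambda sigma^T, lambda diagonal given by its diagonal entries *)
Definition sls d (p : Mat d * Vec d) : Mat d :=
  fun a b => rsum (fun j => fst p a j * snd p j * fst p b j).

Definition seq_conv d (p : nat -> Mat d * Vec d) (q : Mat d * Vec d) :=
  forall eps, 0 < eps -> exists n0, forall n, (n0 <= n)%nat ->
    (forall a b, Rabs (fst (p n) a b - fst q a b) < eps) /\
    (forall j, Rabs (snd (p n) j - snd q j) < eps).

Definition compactF d (F : Mat d * Vec d -> Prop) :=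
  forall p : nat -> Mat d * Vec d, (forall n, F (p n)) ->
    exists (phi : nat -> nat) q, (forall n, (phi n < phi (S n))%nat) /\ F q /\
      seq_conv (fun n => p (phi n)) q.

Definition controls_ok d (F : Mat d * Vec d -> Prop) :=
  compactF F /\
  (forall p, F p -> S1 (sls p)) /\
  (forall p q, F p -> F q -> sls p = sls q -> p = q) /\
  (forall B, S1 B -> exists p, F p /\ sls p = B) /\
  (exists C, 0 < C /\ forall p, F p -> (forall j, 0 <= snd p j) /\ rsum (snd p) = C).

Definition zero_ctrl d : Mat d * Vec d := (fun _ _ => 0, fun _ => 0).
Definition preim d (F : Mat d * Vec d -> Prop) (B : Mat d) : Mat d * Vec d :=
  epsilon (inhabits (zero_ctrl d)) (fun p => F p /\ sls p = B).

Section Scheme.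
Variables (d N M : nat) (pos : 'I_N -> Vec d) (tri : 'I_M -> 'I_d.+1 -> 'I_N)
          (F : Mat d * Vec d -> Prop) (k : Vec d -> R) (f g : Vec d -> R).

Definition Lh (B : Mat d) (s : R) (phi : Vec d -> R) (i : 'I_N) : R :=
  let x := pos i in
  if excluded_middle_informative (interior_node pos tri i) then
    let sg := fst (preim F B) in let lm := snd (preim F B) in
    let kk := k x in
    - rsum (fun j => lm j * (phi (fun c => x c - kk * sg c j) - 2 * s
                              + phi (fun c => x c + kk * sg c j)) / (kk * kk))
    + f x * rootd d (detR B)
  else s - g x.

Definition Hh_is (s : R) (phi : Vec d -> R) (i : 'I_N) (h : R) :=
  is_lub (fun y => exists B, S1 B /\ y = Lh B s phi i) h.

Definition solves_scheme (u : Vec d -> R) :=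
  forall i, Hh_is (u (pos i)) u i 0.

Definition control (Bs : 'I_N -> Mat d) :=
  forall i, interior_node pos tri i -> S1 (Bs i).

Definition howard (B0 : 'I_N -> Mat d) (Bs : nat -> 'I_N -> Mat d) (v : nat -> Vec d -> R) :=
  (forall i, interior_node pos tri i -> Bs 0%nat i = B0 i) /\
  forall l, control (Bs l) /\ inVh pos tri (v l) /\
    (forall i, Lh (Bs l i) (v l (pos i)) (v l) i = 0) /\
    control (Bs (S l)) /\
    (forall i, interior_node pos tri i -> forall B, S1 B ->
        Lh B (v l (pos i)) (v l) i <= Lh (Bs (S l) i) (v l (pos i)) (v l) i).
End Scheme.

(* Main.v *)
(** For every choice of controls the discrete operator is a matrix with
    nonpositive off-diagonal entries. The function psi(x) = const - |x|^2,
    interpolated at the nodes, satisfies (A psi)(x_i) >= 1 for all controls and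
    all nodes, because interpolation only increases the convex function |x|^2
    and the central differences of |x|^2 sum to 2 tr B = 2. Touching by
    multiples of psi gives a comparison principle uniform in the controls, so
    every policy evaluation is a uniquely solvable linear system and the
    iterates of Howard's algorithm decrease and are bounded below. Matrix rows
    and source terms depend continuously on (sigma, lambda) in the compact set F,
    hence the limit solves the scheme, and the policies of the iteration
    approach the optimal policies. Since
      A_{l+1} (v^{l+1} - u) <= (A_{l+1} - A_opt) (v^l - u),
    the convergence is superlinear. *)
From HB Require Import structures.
From mathcomp Require Import all_boot perm ssralg matrix mxalgebra.
From mathcomp Require Import Rstruct.
From Stdlib Require Import Reals ClassicalEpsilon FunctionalExtensionality Lra.
Require Import Defs.
Open Scope R_scope.

(** * Finite sums and sequences *)

Lemma eq_rsum n (F G : 'I_n -> R) : (forall i, F i = G i) -> rsum F = rsum G.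
Proof. by move=> FG; apply: eq_bigr => i _. Qed.

Lemma rsumD n (F G : 'I_n -> R) : rsum (fun i => F i + G i) = rsum F + rsum G.
Proof. exact: big_split. Qed.

Lemma rsumZ n c (F : 'I_n -> R) : rsum (fun i => c * F i) = c * rsum F.
Proof. by rewrite /rsum big_distrr. Qed.

Lemma rsumZr n c (F : 'I_n -> R) : rsum (fun i => F i * c) = rsum F * c.
Proof. by rewrite /rsum big_distrl. Qed.

Lemma rsumN n (F : 'I_n -> R) : rsum (fun i => - F i) = - rsum F.
Proof.
rewrite (_ : - rsum F = -1 * rsum F); last by ring.
by rewrite -rsumZ; apply: eq_rsum => i; ring.
Qed.

Lemma rsumB n (F G : 'I_n -> R) : rsum (fun i => F i - G i) = rsum F - rsum G.
Proof. by rewrite rsumD rsumN. Qed.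

Lemma rsum0 n (F : 'I_n -> R) : (forall i, F i = 0) -> rsum F = 0.
Proof. by move=> F0; apply: big1 => i _. Qed.

Lemma ler_rsum n (F G : 'I_n -> R) :
  (forall i, F i <= G i) -> rsum F <= rsum G.
Proof. by move=> FG; apply: big_ind2 => //; [lra | exact: Rplus_le_compat]. Qed.

Lemma rsum_ge0 n (F : 'I_n -> R) : (forall i, 0 <= F i) -> 0 <= rsum F.
Proof. by move=> F0; apply: big_ind => //; [lra | exact: Rplus_le_le_0_compat]. Qed.

Lemma rsum_ge n (F : 'I_n -> R) j : (forall i, 0 <= F i) -> F j <= rsum F.
Proof.
move=> F0; rewrite /rsum (bigD1 j) //=.
set s := (X in _ + X); have : 0 <= s.
  by apply: big_ind => //; [lra | exact: Rplus_le_le_0_compat].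
lra.
Qed.

Lemma rsum_exchange m n (F : 'I_m -> 'I_n -> R) :
  rsum (fun i => rsum (fun j => F i j)) = rsum (fun j => rsum (fun i => F i j)).
Proof. exact: exchange_big. Qed.

Definition kron {n} (i j : 'I_n) : R := if i == j then 1 else 0.

Lemma kron_ge0 n (i j : 'I_n) : 0 <= kron i j.
Proof. by rewrite /kron; case: eqP => _; lra. Qed.

Lemma rsum_kron n (i : 'I_n) (w : 'I_n -> R) : rsum (fun j => kron i j * w j) = w i.
Proof.
rewrite /rsum (bigD1 i) //= /kron eqxx big1 => [|j /negPf ji].
  by rewrite Rplus_0_r Rmult_1_l.
by rewrite eq_sym ji Rmult_0_l.
Qed.

Lemma rsum_kron1 n (i : 'I_n) : rsum (fun j => kron i j) = 1.
Proof.
rewrite -[RHS](rsum_kron _ i (fun=> 1)).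
by apply: eq_rsum => j; rewrite Rmult_1_r.
Qed.

Lemma exists_max n (w : 'I_n -> R) (i0 : 'I_n) : exists i, forall j, w j <= w i.
Proof.
suff: exists i, forall j, j \in enum 'I_n -> w j <= w i.
  by case=> i wi; exists i => j; apply: wi; rewrite mem_enum.
elim: (enum 'I_n) => [|k s [i IH]]; first by exists i0.
case: (Rle_dec (w i) (w k)) => wik.
  exists k => j; rewrite in_cons => /orP[/eqP ->|/IH]; lra.
exists i => j; rewrite in_cons => /orP[/eqP ->|/IH]; lra.
Qed.

Lemma nodenorm_ge d N (pos : 'I_N -> Vec d) w i : Rabs (w (pos i)) <= nodenorm pos w.
Proof.
rewrite /nodenorm; have := mem_index_enum i.
elim: (index_enum _) => // k s IH; rewrite in_cons big_cons => /orP[/eqP ->|/IH ws].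
  exact: Rmax_l.
exact: Rle_trans ws (Rmax_r _ _).
Qed.

Lemma nodenorm_le d N (pos : 'I_N -> Vec d) w r :
  0 <= r -> (forall i, Rabs (w (pos i)) <= r) -> nodenorm pos w <= r.
Proof.
move=> r0 wr; apply: (big_ind (fun x => x <= r)) => // x y; exact: Rmax_lub.
Qed.

Lemma nodenorm_ge0 d N (pos : 'I_N -> Vec d) w : 0 <= nodenorm pos w.
Proof.
apply: (big_ind (fun x => 0 <= x)) => [||i _]; first lra.
  by move=> x y x0 _; apply: Rle_trans x0 (Rmax_l _ _).
exact: Rabs_pos.
Qed.

Lemma cvP (u : nat -> R) l : Un_cv u l <->
  forall eps, 0 < eps -> exists n0, forall n, (n0 <= n)%nat -> Rabs (u n - l) < eps.
Proof.
split=> ul eps eps0; have [n0 un0] := ul eps eps0; exists n0 => n /leP; exact: un0.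
Qed.

Lemma cv_const c : Un_cv (fun=> c) c.
Proof. by apply/cvP => e e0; exists 0%nat => n _; rewrite Rminus_diag Rabs_R0. Qed.

Lemma eq_cv (u v : nat -> R) l : (forall n, u n = v n) -> Un_cv u l -> Un_cv v l.
Proof. by move=> /functional_extensionality ->. Qed.

Lemma cv_unique (u : nat -> R) l m : Un_cv u l -> Un_cv u m -> l = m.
Proof. exact: UL_sequence. Qed.

Lemma cv_le (u v : nat -> R) l m :
  (forall n, u n <= v n) -> Un_cv u l -> Un_cv v m -> l <= m.
Proof.
move=> uv /cvP ul /cvP vm; apply: Rnot_lt_le => ml.
have [n1 u1] := ul ((l - m) / 2) ltac:(lra).
have [n2 v2] := vm ((l - m) / 2) ltac:(lra).
have := u1 _ (leq_maxl n1 n2); have := v2 _ (leq_maxr n1 n2).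
have := uv (maxn n1 n2); move=> h /Rabs_def2 ? /Rabs_def2 ?; lra.
Qed.

(** The bound [n <= phi n] replaces strict monotonicity: it suffices for the limit, is stable under
    composition and allows index shifts such as [(phi m).+1]. *)
Lemma cv_sub (u : nat -> R) l (phi : nat -> nat) :
  (forall n, (n <= phi n)%nat) -> Un_cv u l -> Un_cv (fun n => u (phi n)) l.
Proof.
move=> phin /cvP ul; apply/cvP => e /ul[n0 h]; exists n0 => n nn.
by apply: h; apply: leq_trans nn (phin n).
Qed.

Lemma cv_big I (r : seq I) (op : R -> R -> R) idx (u : nat -> I -> R) (l : I -> R) :
  (forall s t x y, Un_cv s x -> Un_cv t y -> Un_cv (fun m => op (s m) (t m)) (op x y)) ->
  (forall i, Un_cv (fun m => u m i) (l i)) ->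
  Un_cv (fun m => \big[op/idx]_(i <- r) u m i) (\big[op/idx]_(i <- r) l i).
Proof.
move=> op_cv ul; elim: r => [|k s IH].
  by rewrite big_nil; apply: eq_cv (cv_const idx) => m; rewrite big_nil.
rewrite big_cons; apply: eq_cv (op_cv _ _ _ _ (ul k) IH) => m.
by rewrite big_cons.
Qed.

Lemma cv_rsum n (u : nat -> 'I_n -> R) (l : 'I_n -> R) :
  (forall i, Un_cv (fun m => u m i) (l i)) -> Un_cv (fun m => rsum (u m)) (rsum l).
Proof. by apply: cv_big; apply: CV_plus. Qed.

Lemma subseq_ge (phi : nat -> nat) :
  (forall n, (phi n < phi n.+1)%nat) -> forall n, (n <= phi n)%nat.
Proof. by move=> mono; elim=> // n IH; apply: leq_ltn_trans IH (mono n). Qed.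

Lemma choose_fun I T (Q : I -> T -> Prop) :
  (forall i, exists x, Q i x) -> exists s, forall i, Q i (s i).
Proof.
move=> h; exists (fun i => proj1_sig (constructive_indefinite_description _ (h i))).
by move=> i; case: constructive_indefinite_description.
Qed.

Lemma cv_inv_succ : Un_cv (fun n => / INR n.+1) 0.
Proof.
apply/cvP => e e0; have [N [Ne N0]] := archimed_cor1 e e0; exists N => n /leP Nn.
rewrite Rminus_0_r Rabs_pos_eq; last first.
  by left; apply: Rinv_0_lt_compat; apply: lt_0_INR; apply: Nat.lt_0_succ.
apply: Rlt_trans Ne; apply: Rinv_lt_contravar.
  by apply: Rmult_lt_0_compat; apply: lt_0_INR => //; apply: Nat.lt_0_succ.
by apply: lt_INR; apply/leP; apply: leq_ltn_trans (ltnSn n); apply/leP.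
Qed.

(* Solvability of square linear systems *)
Delimit Scope ring_scope with ring.

Lemma solve_linear N (A : 'I_N -> 'I_N -> R) (b : 'I_N -> R) :
  (forall w, (forall i, rsum (fun n => A i n * w n) = 0) -> forall i, w i = 0) ->
  exists w, forall i, rsum (fun n => A i n * w n) = b i.
Proof.
move=> inj.
pose Am : 'M[R]_N := (\matrix_(i, j) A i j)%ring.
have Amw w i : (Am *m w)%ring i ord0 = rsum (fun n => A i n * (w : 'cV[R]_N) n ord0).
  by rewrite mxE; apply: eq_bigr => j _; rewrite mxE.
have uA : Am \in unitmx.
  (* Rows of the left kernel of the transpose are, once transposed, vectors of the right kernel of
     [Am]; there the injectivity hypothesis applies. *)
  rewrite -unitmx_tr -row_free_unit -kermx_eq0; apply/eqP/row_matrixP => i.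
  rewrite row0; set r := row i _.
  have r0 : (Am *m r^T = 0)%ring.
    by apply: trmx_inj; rewrite trmx_mul trmxK trmx0 /r -row_mul mulmx_ker row0.
  apply/rowP => j; rewrite [RHS]mxE.
  have := inj (fun n => r^T%ring n ord0) _ j; rewrite [r^T%ring _ _]mxE; apply.
  by move=> k; rewrite -Amw r0 mxE.
pose bm : 'cV[R]_N := (\col_i b i)%ring.
exists (fun n => (invmx Am *m bm)%ring n ord0) => i.
by rewrite -Amw mulKVmx // mxE.
Qed.

(** * Policy iteration for M-matrices *)

Section PolicyIteration.
(* [a i p] and [c i p] are the matrix row and the source term of equation [i] under control [p]. *)
Variables (N : nat) (P : Type) (F : P -> Prop).
Variables (a : 'I_N -> P -> 'I_N -> R) (c : 'I_N -> P -> R) (psi : 'I_N -> R).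

Definition lin i p (w : 'I_N -> R) : R := rsum (fun n => a i p n * w n).
Definition res i p w : R := lin i p w + c i p.

(** Convergence of the data of equation [i] instead of the controls themselves, so that [P] needs no
    topology. *)
Definition pconv i (p : nat -> P) (q : P) :=
  (forall n, Un_cv (fun m => a i (p m) n) (a i q n)) /\
  Un_cv (fun m => c i (p m)) (c i q).

Hypothesis F0 : exists p, F p.
Hypothesis offdiag : forall i p n, F p -> n <> i -> a i p n <= 0.
Hypothesis psi_gt0 : forall n, 0 < psi n.
Hypothesis barrier : forall i p, F p -> 1 <= lin i p psi.
Hypothesis compact : forall i (p : nat -> P), (forall n, F (p n)) ->
  exists (phi : nat -> nat) q, (forall n, (n <= phi n)%nat) /\ F q /\
    pconv i (fun n => p (phi n)) q.

Lemma linB i p u w : lin i p (fun n => u n - w n) = lin i p u - lin i p w.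
Proof. by rewrite /lin -rsumB; apply: eq_rsum => n; ring. Qed.

Lemma linZ i p r w : lin i p (fun n => r * w n) = r * lin i p w.
Proof. by rewrite /lin -rsumZ; apply: eq_rsum => n; ring. Qed.

Lemma lin_cv i p q (w : nat -> 'I_N -> R) u :
  pconv i p q -> (forall n, Un_cv (fun m => w m n) (u n)) ->
  Un_cv (fun m => lin i (p m) (w m)) (lin i q u).
Proof. by move=> [ap _] wu; apply: cv_rsum => n; apply: CV_mult. Qed.

Lemma res_cv i p q (w : nat -> 'I_N -> R) u :
  pconv i p q -> (forall n, Un_cv (fun m => w m n) (u n)) ->
  Un_cv (fun m => res i (p m) (w m)) (res i q u).
Proof. by move=> pq wu; apply: CV_plus; [exact: lin_cv | case: pq]. Qed.

(* Touching [w] from above by the multiple of [psi] at a maximum of [w / psi]. *)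
Lemma weighted_max_principle (p : 'I_N -> P) w r :
  (forall i, F (p i)) -> 0 <= r -> (forall i, lin i (p i) w <= r) ->
  forall i, w i <= r * psi i.
Proof.
move=> Fp r0 wr i0.
have [i imax] := exists_max _ (fun n => w n / psi n) i0.
set t := w i / psi i in imax.
have wt n : w n <= t * psi n.
  have := imax n => /(Rmult_le_compat_r _ _ _ (Rlt_le _ _ (psi_gt0 n))).
  by rewrite /Rdiv Rmult_assoc Rinv_l ?Rmult_1_r //; have := psi_gt0 n; lra.
have wi : w i = t * psi i by rewrite /t; field; have := psi_gt0 i; lra.
suff tr : t <= r.
  by apply: Rle_trans (wt i0) _; apply: Rmult_le_compat_r => //; left.
apply: Rnot_lt_le => rt.
(* The difference [w - t * psi] is nonpositive and vanishes at [i], so only products of two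
   nonpositive numbers remain in row [i]. *)
have : 0 <= lin i (p i) (fun n => w n - t * psi n).
  apply: rsum_ge0 => n; case: (eqVneq n i) => [->|/eqP ni].
    by rewrite wi Rminus_diag Rmult_0_r; lra.
  have := offdiag _ _ _ (Fp i) ni; have := wt n => ? ?; nra.
(* Multiplying the barrier inequality by [t] is allowed because [t > r >= 0]. *)
have : t <= t * lin i (p i) psi.
  by rewrite -{1}(Rmult_1_r t); apply: Rmult_le_compat_l; [lra | exact: barrier].
by rewrite linB linZ; have := wr i; lra.
Qed.

Lemma comparison (p : 'I_N -> P) u w :
  (forall i, F (p i)) -> (forall i, lin i (p i) u <= lin i (p i) w) ->
  forall i, u i <= w i.
Proof.
move=> Fp uw i.
suff : u i - w i <= 0 * psi i by rewrite Rmult_0_l; lra.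
apply: (weighted_max_principle p (fun n => u n - w n)) => // [|j]; first lra.
by rewrite linB; have := uw j; lra.
Qed.

(** Comparing a solution of the homogeneous system with 0 from both sides shows that the matrix of
    the policy is injective, hence invertible. *)
Lemma solve_policy (p : 'I_N -> P) :
  (forall i, F (p i)) -> exists w, forall i, res i (p i) w = 0.
Proof.
move=> Fp.
have [w0 z|w wE] := solve_linear N (fun i => a i (p i)) (fun i => - c i (p i)).
  have lin0 j : lin j (p j) (fun=> 0) = 0.
    by apply: rsum0 => n; rewrite Rmult_0_r.
  have zero j : lin j (p j) w0 = 0 by exact: z.
  move=> i; apply: Rle_antisym.
    by apply: (comparison p w0 (fun=> 0)) => // j; rewrite lin0 zero; lra.
  by apply: (comparison p (fun=> 0) w0) => // j; rewrite lin0 zero; lra.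
by exists w => i; rewrite /res /lin wE; ring.
Qed.

(** Extreme value theorem by sequential compactness: first [h] is bounded above, then a maximizing
    sequence has a limit where the supremum is attained. [h] is generic since both residuals and
    sources are maximized. *)
Lemma policy_max i (h : P -> R) :
  (forall p q, (forall n, F (p n)) -> pconv i p q -> Un_cv (fun n => h (p n)) (h q)) ->
  exists q, F q /\ forall p, F p -> h p <= h q.
Proof.
move=> hcont.
have [p0 Fp0] := F0.
have bnd : bound (fun y => exists p, F p /\ y = h p).
  apply: NNPP => nb.
  have /choose_fun[p ph] : forall n, exists q, F q /\ INR n < h q.
    move=> n; apply: NNPP => np; apply: nb; exists (INR n) => y [p [Fp ->]].
    by apply: Rnot_lt_le => lt; apply: np; exists p.
  have [phi [q [phi_ge [Fq pq]]]] := compact i p (fun n => proj1 (ph n)).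
  have /cvP/(_ 1 Rlt_0_1)[n0 hn0] := hcont _ _ (fun n => proj1 (ph (phi n))) pq.
  have [m hm] := INR_unbounded (h q + 1).
  set k := maxn n0 m.
  have /Rabs_def2[h1 _] := hn0 k (leq_maxl _ _).
  have [_ h2] := ph (phi k).
  have : INR m <= INR (phi k).
    apply: le_INR; apply/leP; apply: leq_trans (leq_maxr n0 m) _.
    exact: phi_ge.
  rewrite -/k in h1 *; lra.
have [s [sub slub]] := completeness _ bnd (ex_intro _ (h p0) (ex_intro _ p0 (conj Fp0 erefl))).
have /choose_fun[p ph] : forall n, exists q, F q /\ s - / INR n.+1 < h q.
  move=> n; apply: NNPP => np.
  have : s <= s - / INR n.+1.
    apply: slub => y [p [Fp ->]].
    by apply: Rnot_lt_le => lt; apply: np; exists p.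
  have : 0 < / INR n.+1 by apply: Rinv_0_lt_compat; apply: lt_0_INR; apply: Nat.lt_0_succ.
  lra.
have [phi [q [phi_ge [Fq pq]]]] := compact i p (fun n => proj1 (ph n)).
exists q; split=> // r Fr.
apply: Rle_trans (_ : s <= _); first by apply: sub; exists r.
have hq := hcont _ _ (fun n => proj1 (ph (phi n))) pq.
have cs := CV_minus _ _ _ _ (cv_const s) (cv_sub _ _ _ (phi_ge) cv_inv_succ).
rewrite Rminus_0_r in cs.
by apply: cv_le cs hq => n; left; case: (ph (phi n)).
Qed.

Lemma res_max i w : exists q, F q /\ forall p, F p -> res i p w <= res i q w.
Proof.
apply: (policy_max i) => p q Fp pq.
by apply: (res_cv i p q (fun=> w)) => // n; apply: cv_const.
Qed.

(** The discrete Bellman equation: the maximum of the residual over the controls is zero, with its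
    attainment built in. *)
Definition bellman u :=
  forall i, (forall p, F p -> res i p u <= 0) /\ exists q, F q /\ res i q u = 0.

(** Freeze the policy [q] under which [w] has zero residual: there [u] is a subsolution, and the
    comparison principle applies. *)
Lemma bellman_le u w : (forall i p, F p -> res i p u <= 0) ->
  (forall i, exists q, F q /\ res i q w = 0) -> forall i, u i <= w i.
Proof.
move=> u0 /choose_fun[q qw].
apply: (comparison q) => i; first by case: (qw i).
have [Fq] := qw i; have := u0 i _ Fq; rewrite /res; lra.
Qed.

Lemma bellman_unique u w : bellman u -> bellman w -> forall i, u i = w i.
Proof.
move=> bu bw i; apply: Rle_antisym; apply: bellman_le => j *;
  by [have [h ?] := bu j; auto | have [h ?] := bw j; auto].
Qed.

Definition policy_iteration (p : nat -> 'I_N -> P) (v : nat -> 'I_N -> R) :=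
  forall l, (forall i, F (p l i)) /\ (forall i, res i (p l i) (v l) = 0) /\
    forall i q, F q -> res i q (v l) <= res i (p l.+1 i) (v l).

Lemma policy_iteration_exists (p0 : 'I_N -> P) : (forall i, F (p0 i)) ->
  exists p v, p 0%nat = p0 /\ policy_iteration p v.
Proof.
move=> Fp0.
have /choose_fun[val valE] : forall p : 'I_N -> P,
    exists w, (forall i, F (p i)) -> forall i, res i (p i) w = 0.
  move=> p; case: (excluded_middle_informative (forall i, F (p i))) => Fp.
    by have [w ?] := solve_policy p Fp; exists w.
  (* Inadmissible policies get the dummy value 0, which makes policy evaluation a total function. *)
  by exists (fun=> 0) => /Fp.
have [impr imprE] := choose_fun _ _ _ (fun w => choose_fun _ _ _ (fun i => res_max i w)).
pose p l := iter l (fun q => impr (val q)) p0.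
exists p, (fun l => val (p l)); split=> // l.
have Fp : forall i, F (p l i) by case: l => //= l i; case: (imprE (val (p l)) i).
by split=> //; split=> [|i q Fq]; [exact: valE | case: (imprE (val (p l)) i) => _; exact].
Qed.

(** * Monotone and superlinear convergence of the iterates *)

Section Iterates.
Variables (p : nat -> 'I_N -> P) (v : nat -> 'I_N -> R).
Hypothesis pv : policy_iteration p v.

Let Fp l i : F (p l i). Proof. by have [] := pv l. Qed.
Let res0 l i : res i (p l i) (v l) = 0. Proof. by have [_ []] := pv l. Qed.
Let impr l i q : F q -> res i q (v l) <= res i (p l.+1 i) (v l).
Proof. by have [_ [_]] := pv l; apply. Qed.

(** The improved policy has nonnegative residual at [v l] and zero residual at [v l.+1]; comparison
    under this policy gives the order. *)
Lemma iterates_decr l i : v l.+1 i <= v l i.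
Proof.
move: i; apply: (comparison (p l.+1)) => // i.
have := res0 l.+1 i; have := res0 l i; have := impr l i _ (Fp l i); rewrite /res; lra.
Qed.

Lemma iterates_bounded_below : exists r, forall l i, - r * psi i <= v l i.
Proof.
have /choose_fun[b bc] : forall i, exists b, forall q, F q -> c i q <= b.
  move=> i; have [q [_ hq]] : exists q, F q /\ forall p, F p -> c i p <= c i q.
    by apply: (policy_max i) => s q _ [].
  by exists (c i q).
(* This [r] is nonnegative and dominates every source term, so by the barrier inequality [- r * psi]
   is a subsolution for every policy. *)
pose r := rsum (fun i => Rabs (b i)).
have cr i q : F q -> c i q <= r.
  move=> Fq; apply: Rle_trans (bc i q Fq) _; apply: Rle_trans (Rle_abs _) _.
  by apply: (rsum_ge _ (fun i => Rabs (b i))) => j; apply: Rabs_pos.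
have r0 : 0 <= r by apply: rsum_ge0 => i; apply: Rabs_pos.
exists r => l; apply: (comparison (p l)) => // i.
rewrite linZ; have := cr i _ (Fp l i); have := res0 l i; have := barrier i _ (Fp l i).
rewrite /res; nra.
Qed.

Lemma iterates_limit : exists u, (forall i, Un_cv (fun l => v l i) (u i)) /\ bellman u.
Proof.
have [r rv] := iterates_bounded_below.
have /choose_fun[u vu] : forall i, exists x, Un_cv (fun l => v l i) x.
  move=> i.
  have [|l vl] := decreasing_cv (fun l => v l i) (fun l => iterates_decr l i).
    exists (r * psi i) => _ [l ->]; rewrite /opp_seq; have := rv l i; lra.
  by exists l.
exists u; split=> // i.
have [phi [q [phi_ge [Fq pq]]]] := compact i (fun l => p l.+1 i) (fun l => Fp l.+1 i).
(* Both shifts occur: the policy [p l.+1] has zero residual at [v l.+1] but is a maximizer at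
   [v l]. *)
have v1 n : Un_cv (fun m => v (phi m) n) (u n) by apply: (cv_sub (fun l => v l n)).
have v2 n : Un_cv (fun m => v (phi m).+1 n) (u n).
  by apply: (cv_sub (fun l => v l n) _ (fun m => (phi m).+1)) => // m; apply: ltnW; apply: phi_ge.
have qu : res i q u = 0.
  apply: cv_unique (res_cv _ _ _ _ _ pq v2) _.
  by apply: eq_cv (cv_const 0) => m; rewrite res0.
split; last by exists q.
move=> s Fs; rewrite -qu.
apply: (cv_le _ _ _ _ (fun m => impr (phi m) i s Fs)); last exact: res_cv pq v1.
exact: (cv_sub (fun l => res i s (v l)) _ _ phi_ge (res_cv i (fun=> s) s v u (conj (fun n => cv_const _) (cv_const _)) vu)).
Qed.

Variable u : 'I_N -> R.
Hypothesis bu : bellman u.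

Lemma iterates_cv i : Un_cv (fun l => v l i) (u i).
Proof. by have [w [vw bw]] := iterates_limit; rewrite (bellman_unique u w). Qed.

Lemma bellman_le_iterates l i : u i <= v l i.
Proof.
move: i; apply: bellman_le => i; first by case: (bu i).
by exists (p l i).
Qed.

(* By compactness, the policies of the iteration approach the set of policies
   that are optimal for the solution, although they need not converge. *)
Lemma policies_near_optimal i eps : 0 < eps -> exists l0, forall l, (l0 <= l)%nat ->
  exists q, F q /\ res i q u = 0 /\ rsum (fun n => Rabs (a i (p l.+1 i) n - a i q n)) < eps.
Proof.
move=> eps0; apply: NNPP => far.
(* Otherwise arbitrarily late policies stay [eps] away from every optimal control, yet a subsequence
   of them converges to an optimal one. *)
have /choose_fun[k kP] : forall m, exists j, (m <= j)%nat /\ forall q, F q ->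
    res i q u = 0 -> eps <= rsum (fun n => Rabs (a i (p j.+1 i) n - a i q n)).
  move=> m; apply: NNPP => nk; apply: far; exists m => l ml.
  apply: NNPP => nq; apply: nk; exists l; split=> // q Fq qu.
  by apply: Rnot_lt_le => lt; apply: nq; exists q.
have [phi [q [phi_ge [Fq pq]]]] := compact i (fun m => p (k m).+1 i) (fun l => Fp _ i).
have qu : res i q u = 0.
  apply: cv_unique (res_cv _ _ _ (fun m => v (k (phi m)).+1) u pq _) _.
    move=> n; apply: (cv_sub (fun l => v l n) _ (fun m => (k (phi m)).+1)); last exact: iterates_cv.
    move=> m; apply: leqW; apply: leq_trans (phi_ge m) _; by case: (kP (phi m)).
  by apply: eq_cv (cv_const 0) => m; rewrite res0.
have : eps <= 0.
  apply: (cv_le _ _ _ _ (fun m => proj2 (kP (phi m)) q Fq qu) (cv_const eps)).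
  rewrite -[X in Un_cv _ X](rsum0 N (fun=> 0)) //.
  apply: cv_rsum => n; case: pq => [/(_ n) aq _].
  rewrite -[X in Un_cv _ X]Rabs_R0 -(Rminus_diag (a i q n)); apply: cv_cvabs.
  exact: CV_minus aq (cv_const _).
lra.
Qed.

(** Any factor [eps] is eventually reached: the difference between the rows of the improved policy
    and of a nearby optimal one multiplies the previous error, and the weighted maximum principle
    turns this bound on the operator into a bound on the new error. *)
Lemma iterates_superlinear eps : 0 < eps -> exists l0, forall l, (l0 <= l)%nat ->
  forall r, (forall n, Rabs (v l n - u n) <= r) ->
  forall n, Rabs (v l.+1 n - u n) <= eps * r.
Proof.
move=> eps0.
pose K := rsum psi.
have psiK n : psi n <= K by apply: rsum_ge => m; left.
case: (Rle_dec K 0) => K0.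
  by exists 0%nat => l _ r _ n; have := psiK n; have := psi_gt0 n; lra.
(* The division by [K] compensates the factor [psi n <= K] that the weighted maximum principle
   produces. *)
have e0 : 0 < eps / K by apply: Rdiv_lt_0_compat; lra.
have [l0 l0P] := choose_fun _ _ _ (fun i => policies_near_optimal i _ e0).
exists (\max_i l0 i)%nat => l ll r vr n.
have r0 : 0 <= r by apply: Rle_trans (vr n); apply: Rabs_pos.
have key i : lin i (p l.+1 i) (fun n => v l.+1 n - u n) <= eps / K * r.
  have [|q [Fq [qu aq]]] := l0P i l; first by apply: leq_trans ll; apply: leq_bigmax.
  (* Combines three facts: [p l.+1] does at least as well as [q] at [v l], has zero residual at
     [v l.+1], and [q] has zero residual at [u]. *)
  apply: Rle_trans (_ : lin i (p l.+1 i) (fun n => v l n - u n) - lin i q (fun n => v l n - u n) <= _).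
    have := impr l i q Fq; have := res0 l.+1 i; rewrite !linB; move: qu; rewrite /res; lra.
  rewrite /lin -rsumB; apply: Rle_trans (_ : rsum (fun n => Rabs (a i (p l.+1 i) n - a i q n) * r) <= _).
    apply: ler_rsum => m; apply: Rle_trans (Rle_abs _) _.
    rewrite (_ : _ - _ = (a i (p l.+1 i) m - a i q m) * (v l m - u m)); last by ring.
    by rewrite Rabs_mult; apply: Rmult_le_compat_l => //; apply: Rabs_pos.
  by rewrite rsumZr; apply: Rmult_le_compat_r => //; left.
rewrite Rabs_pos_eq; last by have := bellman_le_iterates l.+1 n; lra.
have er : 0 <= eps / K * r by apply: Rmult_le_pos => //; left.
apply: Rle_trans (weighted_max_principle (p l.+1) _ _ (Fp l.+1) er key n) _.
apply: Rle_trans (Rmult_le_compat_l _ _ _ er (psiK n)) _.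
by apply: Req_le; field; lra.
Qed.
End Iterates.

Lemma bellman_exists : exists u, bellman u.
Proof.
have [p0 Fp0] := F0.
have [p [v [_ pv]]] := policy_iteration_exists (fun=> p0) (fun=> Fp0).
by have [u [_ bu]] := iterates_limit p v pv; exists u.
Qed.
End PolicyIteration.

Arguments lin {N P}.
Arguments res {N P}.
Arguments pconv {N P}.
Arguments bellman {N P}.
Arguments policy_iteration {N P}.

(** * Compactness and properties of the controls *)

(** Induction over the coordinates: each step refines the subsequence so that one more coordinate
    converges, which keeps the limits already obtained. *)
Lemma bolzano_weierstrass n (u : nat -> 'I_n -> R) :
  (forall m i, 0 <= u m i <= 1) ->
  exists (phi : nat -> nat) (l : 'I_n -> R), (forall m, (m <= phi m)%nat) /\
    forall i, Un_cv (fun m => u (phi m) i) (l i).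
Proof.
move=> u01.
suff: exists phi : nat -> nat, (forall m, (m <= phi m)%nat) /\
    forall i, i \in enum 'I_n -> exists l, Un_cv (fun m => u (phi m) i) l.
  case=> phi [phi_ge phi_cv]; exists phi.
  have /choose_fun[l ul] : forall i, exists l, Un_cv (fun m => u (phi m) i) l.
    by move=> i; apply: phi_cv; rewrite mem_enum.
  by exists l.
elim: (enum 'I_n) => [|k s [phi [phi_ge phi_cv]]]; first by exists (fun m => m).
have [l l_adh] := Bolzano_Weierstrass (fun m => u (phi m) k) _ (compact_P3 0 1) (fun m => u01 (phi m) k).
have /choose_fun[chi chiP] : forall m, exists j, (m <= j)%nat /\ Rabs (u (phi j) k - l) < / INR m.+1.
  move=> m; have m0 : 0 < / INR m.+1.
    by apply: Rinv_0_lt_compat; apply: lt_0_INR; apply: Nat.lt_0_succ.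
  have [|j [/leP mj jl]] := l_adh (fun y => Rabs (y - l) < / INR m.+1) m.
    by exists (mkposreal _ m0) => y.
  by exists j.
have chi_ge m : (m <= chi m)%nat by case: (chiP m).
exists (fun m => phi (chi m)); split=> [m|i].
  exact: leq_trans (chi_ge m) (phi_ge _).
rewrite in_cons => /orP[/eqP ->|/phi_cv[x ux]]; last first.
  by exists x; apply: (cv_sub (fun m => u (phi m) i)).
exists l; apply/cvP => e /(proj1 (cvP _ _) cv_inv_succ)[n0 n0e]; exists n0 => m nm.
have [_ ml] := chiP m; apply: Rlt_trans ml _.
by apply: Rle_lt_trans (n0e m nm); rewrite Rminus_0_r; apply: Rle_abs.
Qed.

Lemma rootd_cv d (u : nat -> R) x : (0 < d)%nat ->
  Un_cv u x -> Un_cv (fun m => rootd d (u m)) (rootd d x).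
Proof.
move=> d0 ux; have d0R : 0 < / INR d.
  by apply: Rinv_0_lt_compat; apply: lt_0_INR; apply/leP.
case: (Rlt_dec 0 x) => x0.
  have cont : continuity_pt (fun y => Rpower y (/ INR d)) x.
    apply: derivable_continuous_pt; eexists; exact: derivable_pt_lim_power.
  rewrite {2}/rootd; case: (Rlt_dec 0 x) => //= _.
  have /cvP pcv := continuity_seq _ _ _ cont ux; apply/cvP => e /pcv[n1 h1].
  have [n2 h2] := proj1 (cvP _ _) ux x x0.
  exists (maxn n1 n2) => m; rewrite geq_max => /andP[/h1 m1 /h2 /Rabs_def2[_ m2]].
  by rewrite /rootd; case: (Rlt_dec 0 (u m)) => //= ?; lra.
rewrite {2}/rootd; case: (Rlt_dec 0 x) => //= _; apply/cvP => e e0.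
(* For a limit [x <= 0] the root is 0; eventually [u m] lies below the [d]-th power of [e], and the
   monotone root brings it below [e]. *)
have p0 : 0 < Rpower e (INR d) by apply: exp_pos.
have [n0 h] := proj1 (cvP _ _) ux _ p0; exists n0 => m /h /Rabs_def2[ue _].
rewrite Rminus_0_r /rootd; case: (Rlt_dec 0 (u m)) => um; last by rewrite Rabs_R0.
rewrite Rabs_pos_eq; last by left; apply: exp_pos.
have -> : e = Rpower (Rpower e (INR d)) (/ INR d).
  rewrite Rpower_mult Rinv_r ?Rpower_1 //.
  by apply: not_0_INR; case: (d) d0.
by apply: Rlt_Rpower_l => //; lra.
Qed.

Lemma sls_cv d (p : nat -> Mat d * Vec d) q : seq_conv p q ->
  (forall i j, Un_cv (fun m => fst (p m) i j) (fst q i j)) /\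
  (forall j, Un_cv (fun m => snd (p m) j) (snd q j)) /\
  forall i j, Un_cv (fun m => sls (p m) i j) (sls q i j).
Proof.
move=> pq.
have p1 i j : Un_cv (fun m => fst (p m) i j) (fst q i j).
  by apply/cvP => e /pq[n0 h]; exists n0 => n /h[].
have p2 j : Un_cv (fun m => snd (p m) j) (snd q j).
  by apply/cvP => e /pq[n0 h]; exists n0 => n /h[].
split=> //; split=> // i j; apply: cv_rsum => n.
by apply: CV_mult => //; apply: CV_mult.
Qed.

Lemma detR_cv d (A : nat -> Mat d) B : (forall i j, Un_cv (fun m => A m i j) (B i j)) ->
  Un_cv (fun m => detR (A m)) (detR B).
Proof.
move=> AB; apply: cv_big => [|s]; first exact: CV_plus.
apply: CV_mult; first exact: cv_const.
by apply: cv_big => //; apply: CV_mult.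
Qed.

Lemma S1_inhabited d : (0 < d)%nat -> exists B : Mat d, S1 B.
Proof.
move=> d0; pose i0 := Ordinal d0.
(* The rank-one projection onto a coordinate axis; its quadratic form is the square of one
   coordinate. *)
exists (fun i j => kron i0 i * kron i0 j); split; first by move=> i j; rewrite Rmult_comm.
split=> [v|]; last by rewrite /trace rsum_kron /kron eqxx.
apply: Rle_trans (Rle_0_sqr (v i0)) _; apply: Req_le; rewrite /Rsqr.
rewrite (eq_rsum _ _ (fun i => kron i0 i * (v i * v i0))) ?rsum_kron // => i.
rewrite (eq_rsum _ _ (fun j => kron i0 j * (kron i0 i * v i * v j))) ?rsum_kron; last by move=> j; ring.
by ring.
Qed.

Lemma preimE d (F : Mat d * Vec d -> Prop) B : controls_ok F -> S1 B ->
  F (preim F B) /\ sls (preim F B) = B.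
Proof. by move=> [_ [_ [_ [onto _]]]] /onto FB; exact: (epsilon_spec _ (fun p => F p /\ sls p = B) FB). Qed.

Lemma preim_sls d (F : Mat d * Vec d -> Prop) p : controls_ok F -> F p ->
  preim F (sls p) = p.
Proof.
move=> cF Fp; have [FS [FI _]] := proj2 cF.
by have [Fq qE] := preimE _ _ _ cF (FS p Fp); apply: FI.
Qed.

Lemma trace_sls d (p : Mat d * Vec d) :
  trace (sls p) = rsum (fun j => snd p j * rsum (fun c => fst p c j * fst p c j)).
Proof.
rewrite /trace /sls rsum_exchange; apply: eq_rsum => j.
by rewrite -rsumZ; apply: eq_rsum => c; ring.
Qed.

(** Nonnegativity of the variance under the probability weights [w]. *)
Lemma square_mean_le n (w z : 'I_n -> R) : (forall i, 0 <= w i) -> rsum w = 1 ->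
  rsum (fun i => w i * z i) * rsum (fun i => w i * z i) <= rsum (fun i => w i * (z i * z i)).
Proof.
move=> w0 w1; set b := rsum (fun i => w i * z i).
have : 0 <= rsum (fun i => w i * ((z i - b) * (z i - b))).
  by apply: rsum_ge0 => i; apply: Rmult_le_pos => //; apply: Rle_0_sqr.
rewrite (eq_rsum _ _ (fun i => w i * (z i * z i) - 2 * b * (w i * z i) + b * b * w i)); last by move=> i; ring.
by rewrite rsumD rsumB !rsumZ w1 -/b; lra.
Qed.

(** * Finite element interpolation *)

Section Interpolation.
Variables (d N M : nat) (pos : 'I_N -> Vec d) (tri : 'I_M -> 'I_d.+1 -> 'I_N).
Variable Om : Vec d -> Prop.
Hypothesis mesh : mesh_ok pos tri Om.

(** The barycentric coordinate of node [n], zero if [n] is no vertex of [t]. Indexing by global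
    nodes makes different simplices comparable. *)
Definition weight t (mu : 'I_d.+1 -> R) (n : 'I_N) : R :=
  rsum (fun a => mu a * kron (tri t a) n).

Lemma weightE t mu (H : 'I_N -> R) :
  rsum (fun n => weight t mu n * H n) = rsum (fun a => mu a * H (tri t a)).
Proof.
rewrite /weight (eq_rsum _ _ (fun n => rsum (fun a => mu a * (kron (tri t a) n * H n)))).
  by rewrite rsum_exchange; apply: eq_rsum => a; rewrite rsumZ rsum_kron.
by move=> n; rewrite -rsumZr; apply: eq_rsum => a; ring.
Qed.

Lemma tri_inj t a b : tri t a = tri t b -> a = b.
Proof.
move=> tab; apply/eqP/negPn/negP => /negPf ab.
have [_ [_ [indep _]]] := mesh.
have := indep t (fun e => kron a e - kron b e) _ _ a.
rewrite /kron eqxx eq_sym ab => h; suff : 1 - 0 = 0 by lra.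
apply: h => [|e]; first by rewrite rsumB !rsum_kron1; ring.
rewrite (eq_rsum _ _ (fun i => kron a i * pos (tri t i) e - kron b i * pos (tri t i) e)).
  by rewrite rsumB !rsum_kron tab; ring.
by move=> i; rewrite /kron; ring.
Qed.

Lemma bary_unique t mu nu : rsum mu = rsum nu ->
  comb pos tri t mu = comb pos tri t nu -> forall a, mu a = nu a.
Proof.
move=> smn cmn a; have [_ [_ [indep _]]] := mesh.
suff : mu a - nu a = 0 by lra.
apply: (indep t (fun a => mu a - nu a)) => [|e]; first by rewrite rsumB smn; ring.
rewrite (eq_rsum _ _ (fun i => mu i * pos (tri t i) e - nu i * pos (tri t i) e)); last by move=> i; ring.
by rewrite rsumB; move: (f_equal (fun y : Vec d => y e) cmn); rewrite /comb => ->; ring.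
Qed.

(** Makes the nodal basis well defined: by conformity the coordinates in [t1] live on vertices
    shared with [t2], and read in [t2] they equal [mu2] by affine independence. *)
Lemma weight_unique t1 t2 mu1 mu2 : bary mu1 -> bary mu2 ->
  comb pos tri t1 mu1 = comb pos tri t2 mu2 ->
  forall n, weight t1 mu1 n = weight t2 mu2 n.
Proof.
move=> b1 b2 y12.
have [_ [_ [_ [conf _]]]] := mesh.
have [||mu [bmu [ymu supp]]] := conf t1 t2 (comb pos tri t1 mu1).
- by exists mu1.
- by exists mu2.
have mu1E a : mu a = mu1 a.
  by apply: (bary_unique t1) => //; case: b1 => _ ->; case: bmu.
have supp1 a : mu1 a <> 0 -> exists b, tri t2 b = tri t1 a by rewrite -mu1E; apply: supp.
(* The coordinates [mu1], transported to the vertices of [t2]. *)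
pose nu b := weight t1 mu1 (tri t2 b).
have nuE (H : 'I_N -> R) : rsum (fun b => nu b * H (tri t2 b)) = rsum (fun a => mu1 a * H (tri t1 a)).
  rewrite (eq_rsum _ _ (fun b => rsum (fun a => mu1 a * (kron (tri t1 a) (tri t2 b) * H (tri t2 b))))); last first.
    by move=> b; rewrite -rsumZr; apply: eq_rsum => a; ring.
  rewrite rsum_exchange; apply: eq_rsum => a; rewrite rsumZ.
  case: (Req_dec (mu1 a) 0) => [->|/supp1[b0 <-]]; first by ring.
  rewrite (eq_rsum _ _ (fun b => kron b0 b * H (tri t2 b))) ?rsum_kron // => b.
  by rewrite /kron (inj_eq (fun x y => @tri_inj t2 x y)).
have nu2 b : nu b = mu2 b.
  apply: (bary_unique t2).
    case: b2 => _ ->; case: b1 => _ <-; rewrite -[rsum mu1]Rmult_1_r -[rsum nu]Rmult_1_r.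
    by rewrite -!rsumZr; apply: (nuE (fun=> 1)).
  by rewrite -y12; apply: functional_extensionality => e; apply: (nuE (fun n => pos n e)).
move=> n; rewrite /weight -(nuE (fun m => kron m n)).
by apply: eq_rsum => b; rewrite nu2.
Qed.

(* Junk outside the closed mesh, where no barycentric representation exists. *)
Definition hat (n : 'I_N) (y : Vec d) : R :=
  epsilon (inhabits 0) (fun r => exists t mu, bary mu /\ y = comb pos tri t mu /\ r = weight t mu n).

Lemma hat_comb n t mu : bary mu -> hat n (comb pos tri t mu) = weight t mu n.
Proof.
move=> bmu; rewrite /hat; set Q := (fun r => _).
have [|t' [nu [bnu [ynu ->]]]] := epsilon_spec (inhabits 0) Q.
  by exists (weight t mu n); exists t, mu.
exact: weight_unique.
Qed.

Definition interp (w : 'I_N -> R) (y : Vec d) : R := rsum (fun n => hat n y * w n).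

Lemma interp_comb w t mu : bary mu ->
  interp w (comb pos tri t mu) = rsum (fun a => mu a * w (tri t a)).
Proof. by move=> bmu; rewrite -weightE; apply: eq_rsum => n; rewrite hat_comb. Qed.

Lemma pos_comb n : exists t mu, bary mu /\ pos n = comb pos tri t mu /\
  forall w : 'I_N -> R, rsum (fun a => mu a * w (tri t a)) = w n.
Proof.
have [_ [cover _]] := mesh; have [t [a <-]] := cover n; exists t, (kron a).
split; first by split=> [b|]; [exact: kron_ge0 | exact: rsum_kron1].
split=> [|w]; last by rewrite rsum_kron.
by apply: functional_extensionality => e; rewrite /comb rsum_kron.
Qed.

Lemma interp_pos w n : interp w (pos n) = w n.
Proof. by have [t [mu [bmu [-> <-]]]] := pos_comb n; rewrite interp_comb. Qed.

Lemma interp_inVh w : inVh pos tri (interp w).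
Proof. by move=> t mu bmu; rewrite interp_comb //; apply: eq_rsum => a; rewrite interp_pos. Qed.

Lemma inVh_interp phi y : inVh pos tri phi -> Omh_bar pos tri y ->
  phi y = interp (fun n => phi (pos n)) y.
Proof. by move=> Vphi [t [mu [bmu ->]]]; rewrite interp_comb // Vphi. Qed.

Lemma hat_ge0 n y : Omh_bar pos tri y -> 0 <= hat n y.
Proof.
move=> [t [mu [bmu ->]]]; rewrite hat_comb //; apply: rsum_ge0 => a.
by apply: Rmult_le_pos; [case: bmu | exact: kron_ge0].
Qed.

Lemma hat_sum1 y : Omh_bar pos tri y -> rsum (fun n => hat n y) = 1.
Proof.
move=> [t [mu [bmu ->]]]; have [_ <-] := bmu.
rewrite -[LHS]Rmult_1_r -[RHS]Rmult_1_r -!rsumZr; exact: (interp_comb (fun=> 1)).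
Qed.

Lemma interp_coord y e : Omh_bar pos tri y -> interp (fun n => pos n e) y = y e.
Proof. by move=> [t [mu [bmu ->]]]; rewrite interp_comb. Qed.

Lemma interp_affine a b w y : Omh_bar pos tri y ->
  interp (fun n => a + b * w n) y = a + b * interp w y.
Proof.
move=> yO; rewrite /interp (eq_rsum _ _ (fun n => hat n y * a + b * (hat n y * w n))).
  by rewrite rsumD rsumZ rsumZr hat_sum1 // Rmult_1_l.
by move=> n; ring.
Qed.

Definition sqnorm (y : Vec d) : R := rsum (fun e => y e * y e).

(** Jensen's inequality in each coordinate: the hat values at [y] are convex weights that reproduce
    the coordinates of [y]. *)
Lemma sqnorm_le_interp y : Omh_bar pos tri y ->
  sqnorm y <= interp (fun n => sqnorm (pos n)) y.
Proof.
move=> yO; rewrite /interp /sqnorm.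
rewrite (eq_rsum _ (fun n => hat n y * _) (fun n => rsum (fun e => hat n y * (pos n e * pos n e)))); last first.
  by move=> n; rewrite -rsumZ.
rewrite rsum_exchange; apply: ler_rsum => e; rewrite -{1 2}(interp_coord y e yO).
by apply: square_mean_le => [n|]; [exact: hat_ge0 | exact: hat_sum1].
Qed.

(** The points may switch simplices, so each of the finitely many simplices gets its own threshold.
    Within one simplex the barycentric coordinates have a convergent subsequence, whose limit
    represents [z]. *)
Lemma hat_cv n (y : nat -> Vec d) z : (forall m, Omh_bar pos tri (y m)) ->
  (forall e, Un_cv (fun m => y m e) (z e)) -> Un_cv (fun m => hat n (y m)) (hat n z).
Proof.
move=> yO yz; apply/cvP => eps eps0.
suff /choose_fun[n0 h] : forall t, exists n0, forall m, (n0 <= m)%nat ->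
    in_simplex pos tri t (y m) -> Rabs (hat n (y m) - hat n z) < eps.
  exists (\max_t n0 t)%nat => m mn; have [t yt] := yO m.
  by apply: h yt; apply: leq_trans mn; apply: leq_bigmax.
move=> t; apply: NNPP => far.
have /choose_fun[k kP] : forall j, exists m, (j <= m)%nat /\ in_simplex pos tri t (y m) /\
    eps <= Rabs (hat n (y m) - hat n z).
  move=> j; apply: NNPP => nk; apply: far; exists j => m jm yt.
  by apply: Rnot_le_lt => le; apply: nk; exists m.
have /choose_fun[mu muP] : forall j, exists mu, bary mu /\ y (k j) = comb pos tri t mu.
  by move=> j; case: (kP j) => _ [].
have [|phi [nu [phi_ge munu]]] := bolzano_weierstrass _ mu.
  by move=> m a; case: (muP m) => -[mu0 <-] _; split=> //; apply: rsum_ge.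
have bnu : bary nu.
  split=> [a|].
    apply: (cv_le _ _ _ _ _ (cv_const 0) (munu a)) => m.
    by case: (muP (phi m)) => -[].
  apply: cv_unique (cv_rsum _ (fun m => mu (phi m)) nu munu) _.
  by apply: eq_cv (cv_const 1) => m; case: (muP (phi m)) => -[].
have znu : z = comb pos tri t nu.
  apply: functional_extensionality => e.
  apply: cv_unique (cv_sub _ _ (fun m => k (phi m)) _ (yz e)) _.
    by move=> m; apply: leq_trans (phi_ge m) _; case: (kP (phi m)).
  apply: (eq_cv (fun m => comb pos tri t (mu (phi m)) e)).
    by move=> m; case: (muP (phi m)) => _ ->.
  by apply: cv_rsum => a; apply: CV_mult => //; apply: cv_const.
have : Un_cv (fun m => hat n (y (k (phi m)))) (hat n z).
  rewrite znu hat_comb //; apply: (eq_cv (fun m => weight t (mu (phi m)) n)).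
    by move=> m; case: (muP (phi m)) => bm ->; rewrite hat_comb.
  by apply: cv_rsum => a; apply: CV_mult => //; apply: cv_const.
move/cvP/(_ eps eps0) => [n0 /(_ n0 (leqnn _))]; case: (kP (phi n0)) => _ [_]; lra.
Qed.
End Interpolation.

Arguments sqnorm {d}.

Arguments hat {d N M}.
Arguments interp {d N M}.

(** * The discrete Hamiltonian *)

Section DiscreteHamiltonian.
Variables (d N M : nat) (pos : 'I_N -> Vec d) (tri : 'I_M -> 'I_d.+1 -> 'I_N).
Variables (Om : Vec d -> Prop) (F : Mat d * Vec d -> Prop) (k f g : Vec d -> R).
Hypothesis d_gt0 : (0 < d)%nat.
Hypothesis mesh : mesh_ok pos tri Om.
Hypothesis ctrl : controls_ok F.
Hypothesis stencil : forall x, Omh pos tri x -> 0 < k x /\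
  forall p j, F p ->
    Omh_bar pos tri (fun c => x c + k x * fst p c j) /\
    Omh_bar pos tri (fun c => x c - k x * fst p c j).

Local Notation interior := (interior_node pos tri).
Local Notation fwd i p j := (fun c => pos i c + k (pos i) * fst p c j).
Local Notation bwd i p j := (fun c => pos i c - k (pos i) * fst p c j).

(** The central differences with the values at the stencil points expanded in the hat functions;
    boundary nodes carry an identity row. *)
Definition row (i : 'I_N) (p : Mat d * Vec d) (n : 'I_N) : R :=
  if excluded_middle_informative (interior i) then
    rsum (fun j => snd p j / (k (pos i) * k (pos i)) *
      (2 * kron i n - hat pos tri n (bwd i p j) - hat pos tri n (fwd i p j)))
  else kron i n.

Definition source (i : 'I_N) (p : Mat d * Vec d) : R :=
  if excluded_middle_informative (interior i) then f (pos i) * rootd d (detR (sls p))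
  else - g (pos i).

(** The sum dominates every single [sqnorm (pos n)], which keeps the function at least 1, as the
    identity rows at the boundary require. *)
Definition barrier_fun (n : 'I_N) : R :=
  1 + rsum (fun m => sqnorm (pos m)) - sqnorm (pos n).

Lemma lin_interior i p w : interior i ->
  lin row i p w = rsum (fun j => snd p j / (k (pos i) * k (pos i)) *
      (2 * w i - interp pos tri w (bwd i p j) - interp pos tri w (fwd i p j))).
Proof.
move=> ii; rewrite /lin /row; case: excluded_middle_informative => //= _.
rewrite (eq_rsum _ _ (fun n => rsum (fun j => snd p j / (k (pos i) * k (pos i)) *
   ((2 * kron i n - hat pos tri n (bwd i p j) - hat pos tri n (fwd i p j)) * w n)))); last first.
  by move=> n; rewrite -rsumZr; apply: eq_rsum => j; ring.
rewrite rsum_exchange; apply: eq_rsum => j; rewrite rsumZ; congr (_ * _).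
rewrite -(rsum_kron _ i w) /interp -rsumZ -!rsumB.
by apply: eq_rsum => n; ring.
Qed.

Lemma lin_boundary i p w : ~ interior i -> lin row i p w = w i.
Proof.
move=> ii; rewrite /lin /row; case: excluded_middle_informative => //= _.
exact: rsum_kron.
Qed.

(** The stencil points lie in the closed mesh, where a function of V_h equals the interpolant of its
    nodal values; the scheme thus becomes a linear residual. *)
Lemma Lh_res phi B i : inVh pos tri phi -> S1 B ->
  Lh pos tri F k f g B (phi (pos i)) phi i = res row source i (preim F B) (fun n => phi (pos n)).
Proof.
move=> Vphi SB; have [Fp pB] := preimE _ _ _ ctrl SB.
rewrite /res /Lh /source; case: excluded_middle_informative => //= ii.
  have [_ st] := stencil _ ii.
  rewrite lin_interior // pB -rsumN; congr (_ + _); apply: eq_rsum => j.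
  have [fO bO] := st _ j Fp.
  rewrite (inVh_interp _ _ _ _ _ _ mesh _ _ Vphi fO).
  rewrite (inVh_interp _ _ _ _ _ _ mesh _ _ Vphi bO).
  by rewrite /Rdiv; ring.
by rewrite lin_boundary //; ring.
Qed.

Lemma controls_nonneg p j : F p -> 0 <= snd p j.
Proof. by have [_ [_ [_ [_ [C [_ h]]]]]] := ctrl => /h[]. Qed.

Lemma row_offdiag i p n : F p -> n <> i -> row i p n <= 0.
Proof.
move=> Fp /eqP/negPf ni; rewrite /row /kron eq_sym ni.
case: excluded_middle_informative => /= ii; last lra.
have [k0 st] := stencil _ ii.
suff: 0 <= rsum (fun j => snd p j / (k (pos i) * k (pos i)) *
      (hat pos tri n (bwd i p j) + hat pos tri n (fwd i p j))).
  move=> s0; apply: Rle_trans (_ : - rsum (fun j => snd p j / (k (pos i) * k (pos i)) *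
      (hat pos tri n (bwd i p j) + hat pos tri n (fwd i p j))) <= _); last lra.
  by rewrite -rsumN; apply: Req_le; apply: eq_rsum => j; ring.
apply: rsum_ge0 => j; have [fO bO] := st _ j Fp.
apply: Rmult_le_pos.
  apply: Rle_mult_inv_pos; first exact: controls_nonneg.
  exact: Rmult_lt_0_compat.
by apply: Rplus_le_le_0_compat; apply: hat_ge0 mesh _ _ _.
Qed.

Lemma barrier_fun_ge1 n : 1 <= barrier_fun n.
Proof.
have := rsum_ge _ (fun m => sqnorm (pos m)) n; rewrite /barrier_fun => h.
suff : sqnorm (pos n) <= rsum (fun m => sqnorm (pos m)) by lra.
by apply: h => m; apply: rsum_ge0 => e; apply: Rle_0_sqr.
Qed.

(* Interpolation increases the convex function [|x|^2], and its second
   differences along the [sigma_j] add up to [2 * trace (sls p) = 2]. *)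
Lemma lin_barrier_fun i p : F p -> 1 <= lin row i p barrier_fun.
Proof.
move=> Fp; case: (excluded_middle_informative (interior i)) => ii; last first.
  by rewrite lin_boundary //; apply: barrier_fun_ge1.
have [k0 st] := stencil _ ii.
rewrite lin_interior //.
apply: Rle_trans (_ : 2 * trace (sls p) <= _).
  have [_ [/(_ _ Fp)[_ [_ ->]] _]] := ctrl; lra.
rewrite trace_sls -rsumZ; apply: ler_rsum => j; have [fO bO] := st _ j Fp.
have interp_barrier y : Omh_bar pos tri y ->
    interp pos tri barrier_fun y <= 1 + rsum (fun m => sqnorm (pos m)) - sqnorm y.
  move=> yO; have := interp_affine _ _ _ _ _ _ mesh
    (1 + rsum (fun m => sqnorm (pos m))) (-1) (fun n => sqnorm (pos n)) y yO.
  have := sqnorm_le_interp _ _ _ _ _ _ mesh y yO.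
  rewrite /interp (eq_rsum _ (fun n => _ * barrier_fun n) (fun n => hat pos tri n y *
    (1 + rsum (fun m => sqnorm (pos m)) + -1 * sqnorm (pos n)))) => [|n]; last first.
    by rewrite /barrier_fun; ring.
  lra.
have := interp_barrier _ fO; have := interp_barrier _ bO.
set If := interp pos tri _ _; set Ib := interp pos tri _ _ => hb hf.
have par : sqnorm (bwd i p j) + sqnorm (fwd i p j) - 2 * sqnorm (pos i) =
    k (pos i) * k (pos i) * (2 * rsum (fun c => fst p c j * fst p c j)).
  rewrite /sqnorm -!rsumZ -rsumD -rsumB; apply: eq_rsum => c; ring.
rewrite (_ : 2 * _ = snd p j / (k (pos i) * k (pos i)) *
    (k (pos i) * k (pos i) * (2 * rsum (fun c => fst p c j * fst p c j)))); last first.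
  by field; lra.
apply: Rmult_le_compat_l.
  by apply: Rle_mult_inv_pos; [exact: controls_nonneg | exact: Rmult_lt_0_compat].
rewrite -par /barrier_fun; lra.
Qed.

(** A subsequence converges in [F]; its stencil points stay in the closed mesh, so the continuity of
    hat functions, determinant and root carries the convergence to rows and sources. *)
Lemma policies_compact i (p : nat -> Mat d * Vec d) : (forall n, F (p n)) ->
  exists (phi : nat -> nat) q, (forall n, (n <= phi n)%nat) /\ F q /\
    pconv row source i (fun n => p (phi n)) q.
Proof.
move=> Fp; have [cF _] := ctrl.
have [phi [q [phi_lt [Fq /sls_cv[s_cv [l_cv sls_cv]]]]]] := cF p Fp.
exists phi, q; split; first exact: subseq_ge.
split=> //; split=> [n|]; rewrite /row /source; case: excluded_middle_informative => //= ii.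
- have [_ st] := stencil _ ii.
  apply: cv_rsum => j; apply: CV_mult.
    by apply: CV_mult => //; apply: cv_const.
  apply: CV_minus; first apply: CV_minus; first exact: cv_const.
    apply: hat_cv mesh _ _ _ _ _ => [m|e]; first by have [] := st (p (phi m)) j (Fp _).
    by apply: CV_minus; [exact: cv_const | apply: CV_mult => //; exact: cv_const].
  apply: hat_cv mesh _ _ _ _ _ => [m|e]; first by have [] := st (p (phi m)) j (Fp _).
  by apply: CV_plus; [exact: cv_const | apply: CV_mult => //; exact: cv_const].
- exact: cv_const.
- apply: CV_mult; first exact: cv_const.
  by apply: rootd_cv => //; apply: detR_cv.
- exact: cv_const.
Qed.

(** [preim] and [sls] translate between matrices and controls, and compactness turns the supremum in
    the Hamiltonian into a maximum. *)
Lemma solves_scheme_bellman u : inVh pos tri u ->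
  solves_scheme pos tri F k f g u <-> bellman F row source (fun n => u (pos n)).
Proof.
move=> Vu; have [B0 SB0] := S1_inhabited d d_gt0.
have F0 : exists p, F p by have [Fp _] := preimE _ _ _ ctrl SB0; exists (preim F B0).
split=> su i.
  have [ub lub] := su i.
  have le0 p : F p -> res row source i p (fun n => u (pos n)) <= 0.
    move=> Fp; apply: ub; exists (sls p); have Sp : S1 (sls p) by have [_ [h _]] := ctrl; apply: h.
    by rewrite Lh_res // preim_sls.
  split=> //.
  have [q [Fq qmax]] := res_max N _ F row source F0 policies_compact i (fun n => u (pos n)).
  exists q; split=> //; apply: Rle_antisym; first exact: le0.
  apply: lub => _ [B [SB ->]]; rewrite Lh_res //; apply: qmax.
  by have [] := preimE _ _ _ ctrl SB.
have [le0 [q [Fq q0]]] := su i; split=> [_ [B [SB ->]]|b bub].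
  by rewrite Lh_res //; apply: le0; have [] := preimE _ _ _ ctrl SB.
apply: bub; exists (sls q); have Sq : S1 (sls q) by have [_ [h _]] := ctrl; apply: h.
by rewrite Lh_res // preim_sls.
Qed.

(** * Howard's algorithm as an abstract policy iteration *)

Definition policy (p0 : Mat d * Vec d) (Bs : 'I_N -> Mat d) (i : 'I_N) : Mat d * Vec d :=
  if excluded_middle_informative (interior i) then preim F (Bs i) else p0.

Lemma res_boundary i p q w : ~ interior i -> res row source i p w = res row source i q w.
Proof.
by move=> ii; rewrite /res !lin_boundary // /source; case: excluded_middle_informative.
Qed.

Lemma Lh_policy p0 phi Bs i : inVh pos tri phi -> control pos tri Bs ->
  Lh pos tri F k f g (Bs i) (phi (pos i)) phi i = res row source i (policy p0 Bs i) (fun n => phi (pos n)).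
Proof.
move=> Vphi cB; rewrite /policy; case: excluded_middle_informative => /= ii.
  by rewrite Lh_res //; apply: cB.
rewrite /Lh /res lin_boundary // /source; case: excluded_middle_informative => //= _; ring.
Qed.

Lemma policy_F p0 Bs i : F p0 -> control pos tri Bs -> F (policy p0 Bs i).
Proof.
move=> Fp0 cB; rewrite /policy; case: excluded_middle_informative => //= ii.
by have [] := preimE _ _ _ ctrl (cB i ii).
Qed.

Lemma howard_policy_iteration p0 B0 Bs v : F p0 -> howard pos tri F k f g B0 Bs v ->
  policy_iteration F row source (fun l => policy p0 (Bs l)) (fun l n => v l (pos n)).
Proof.
move=> Fp0 [_ how] l; have [cB [Vv [eq0 [cB' mx]]]] := how l.
split=> [i|]; first exact: policy_F.
split=> [i|i q Fq]; first by rewrite -Lh_policy.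
case: (excluded_middle_informative (interior i)) => ii; last first.
  by apply: Req_le; apply: res_boundary.
rewrite -Lh_policy //; have Sq : S1 (sls q) by have [_ [h _]] := ctrl; apply: h.
by have := mx i ii _ Sq; rewrite (Lh_res _ (sls q)) // preim_sls.
Qed.

Lemma howard_exists p0 B0 : F p0 -> control pos tri B0 ->
  exists Bs v, howard pos tri F k f g B0 Bs v.
Proof.
move=> Fp0 cB0.
have [p [v [p0E pv]]] := policy_iteration_exists _ _ F row source barrier_fun
  (ex_intro _ p0 Fp0) row_offdiag (fun n => Rlt_le_trans _ _ _ Rlt_0_1 (barrier_fun_ge1 n))
  lin_barrier_fun policies_compact (policy p0 B0) (fun i => policy_F p0 B0 i Fp0 cB0).
(* Index 0 keeps the prescribed [B0]; later matrices come from the controls through [sls], which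
   [preim] inverts. *)
pose Bs l := if l is 0%nat then B0 else fun i => sls (p l i).
have S1p l i : S1 (sls (p l i)).
  by have [_ [h _]] := ctrl; apply: h; have [] := pv l.
have cB l : control pos tri (Bs l) by case: l => //= l i _; apply: S1p.
have Bp l i : interior i -> preim F (Bs l i) = p l i.
  move=> ii; case: l => /= [|l]; last by apply: preim_sls => //; have [] := pv l.+1.
  by rewrite p0E /policy; case: excluded_middle_informative.
have Vv l : inVh pos tri (interp pos tri (v l)) by apply: interp_inVh mesh _.
have vE l : (fun n => interp pos tri (v l) (pos n)) = v l.
  by apply: functional_extensionality => n; apply: interp_pos mesh _ _.
have LhE l m i : interior i ->
    Lh pos tri F k f g (Bs l i) (interp pos tri (v m) (pos i)) (interp pos tri (v m)) i = res row source i (p l i) (v m).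
  by move=> ii; rewrite Lh_res ?vE ?Bp //; apply: cB.
exists Bs, (fun l => interp pos tri (v l)); split=> // l.
have [_ [res0 impr]] := pv l.
split=> //; split=> //; split=> [i|].
  rewrite (Lh_policy p0) // vE -(res0 i).
  case: (excluded_middle_informative (interior i)) => ii; last exact: res_boundary.
  by rewrite /policy; case: excluded_middle_informative => //= _; rewrite Bp.
split=> // i ii B SB; rewrite LhE // Lh_res // vE; apply: impr.
by have [] := preimE _ _ _ ctrl SB.
Qed.
End DiscreteHamiltonian.

(** * Well-posedness of the scheme and convergence on the closed mesh *)

Theorem theorem5p2 (d : nat) (Om : Vec d -> Prop) (f : Vec d -> R)
  (N M : nat) (pos : 'I_N -> Vec d) (tri : 'I_M -> 'I_d.+1 -> 'I_N)
  (F : Mat d * Vec d -> Prop) (k : Vec d -> R) :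
  (2 <= d)%nat ->
  (* Omega: bounded open strictly convex *)
  is_open Om -> is_bounded Om -> strictly_convex Om ->
  (* f : Omega -> [0,oo) bounded and continuous *)
  (forall x, Om x -> 0 <= f x) ->
  (exists Mf, forall x, Om x -> Rabs (f x) <= Mf) ->
  (forall x, Om x -> forall eps, 0 < eps -> exists delta, 0 < delta /\
      forall y, Om y -> vdist y x < delta -> Rabs (f y - f x) < eps) ->
  (* the mesh *)
  mesh_ok pos tri Om ->
  (* the controls *)
  controls_ok F ->
  (* stencil size *)
  (forall x, Omh pos tri x -> 0 < k x /\
     forall p j, F p ->
       Omh_bar pos tri (fun c => x c + k x * fst p c j) /\
       Omh_bar pos tri (fun c => x c - k x * fst p c j)) ->
  forall g : Vec d -> R,
  (exists Mg, forall x, boundaryS Om x -> Rabs (g x) <= Mg) ->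
  exists uh : Vec d -> R,
    (* existence *)
    inVh pos tri uh /\ solves_scheme pos tri F k f g uh /\
    (* uniqueness in V_h *)
    (forall u, inVh pos tri u -> solves_scheme pos tri F k f g u ->
       forall x, Omh_bar pos tri x -> u x = uh x) /\
    (* Howard's algorithm: well defined from any starting control ... *)
    (forall B0, control pos tri B0 ->
       (exists Bs v, howard pos tri F k f g B0 Bs v) /\
    (* ... and any generated sequence converges monotonically decreasingly
       and superlinearly to uh *)
       forall Bs v, howard pos tri F k f g B0 Bs v ->
         (forall l x, Omh_bar pos tri x -> v (S l) x <= v l x) /\
         (forall x, Omh_bar pos tri x -> forall eps, 0 < eps ->
            exists l0, forall l, (l0 <= l)%nat -> Rabs (v l x - uh x) < eps) /\
         (exists epsl : nat -> R,
            (forall eps, 0 < eps -> exists l0, forall l, (l0 <= l)%nat -> Rabs (epsl l) < eps) /\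
            forall l, nodenorm pos (fun x => v (S l) x - uh x)
                      <= epsl l * nodenorm pos (fun x => v l x - uh x))).
Proof.
move=> d2 _ _ _ _ _ _ mesh ctrl stencil g _.
have d0 : (0 < d)%nat by apply: ltn_trans d2.
have [B0' SB0'] := S1_inhabited d d0.
have [Fp0 _] := preimE _ _ _ ctrl SB0'; set p0 := preim F B0' in Fp0.
set a := row d N M pos tri k; set c := source d N M pos tri f g.
set psi := barrier_fun d N pos.
have F0 : exists p, F p by exists p0.
have offdiag := row_offdiag _ _ _ _ _ _ _ _ mesh ctrl stencil.
have psi0 n : 0 < psi n := Rlt_le_trans _ _ _ Rlt_0_1 (barrier_fun_ge1 _ _ pos n).
have barrier := lin_barrier_fun _ _ _ _ _ _ _ _ mesh ctrl stencil.
have compact := policies_compact _ _ _ _ _ _ _ _ f g d0 mesh ctrl stencil.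
have [w bw] := bellman_exists _ _ F a c psi F0 offdiag psi0 barrier compact.
pose uh := interp pos tri w.
have Vuh : inVh pos tri uh by apply: interp_inVh mesh _.
have uhw n : uh (pos n) = w n by apply: interp_pos mesh _ _.
have interpE phi x : inVh pos tri phi -> Omh_bar pos tri x ->
    phi x = interp pos tri (fun n => phi (pos n)) x.
  by move=> Vphi xO; apply: inVh_interp mesh _ _ Vphi xO.
have scheme u (Vu : inVh pos tri u) := solves_scheme_bellman _ _ _ _ _ _ _ _ f g d0 mesh ctrl stencil u Vu.
have buh : bellman F a c (fun n => uh (pos n)).
  by rewrite (functional_extensionality _ _ uhw).
exists uh; split=> //; split; first exact/scheme.
split=> [u Vu /(scheme u Vu) bu x xO|B0 cB0].
  rewrite (interpE u) // (interpE uh) //; apply: eq_rsum => n; congr (_ * _).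
  exact: bellman_unique offdiag psi0 barrier _ _ bu buh n.
split; first exact: howard_exists d0 mesh ctrl stencil p0 B0 Fp0 cB0.
move=> Bs v how.
have pv := howard_policy_iteration _ _ _ _ _ _ _ _ _ _ mesh ctrl stencil p0 B0 Bs v Fp0 how.
have Vv l : inVh pos tri (v l) by have [_ [? _]] := proj2 how l.
have decr := iterates_decr _ _ _ _ _ _ offdiag psi0 barrier _ _ pv.
split; [|split].
- move=> l x xO; rewrite (interpE _ x (Vv l.+1)) // (interpE _ x (Vv l)) //; apply: ler_rsum => n.
  (* Nonnegative hat functions carry the nodal order to all points of the mesh. *)
  apply: Rmult_le_compat_l; last exact: decr.
  exact: hat_ge0 mesh _ _ xO.
- move=> x xO; apply/cvP; rewrite (interpE uh) //.
  apply: (eq_cv (fun l => interp pos tri (fun n => v l (pos n)) x)) => [l|].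
    by rewrite -(interpE (v l)).
  apply: cv_rsum => n; apply: CV_mult; first exact: cv_const.
  exact: (iterates_cv _ _ _ _ _ _ F0 offdiag psi0 barrier compact _ _ pv _ buh).
pose err l := nodenorm pos (fun x => v l x - uh x).
have super eps : 0 < eps -> exists l0, forall l, (l0 <= l)%nat -> err l.+1 <= eps * err l.
  move=> eps0; have [l0 h] := iterates_superlinear _ _ _ _ _ _ F0 offdiag psi0 barrier
    compact _ _ pv _ buh eps eps0.
  exists l0 => l /h{}h; apply: nodenorm_le => [|i].
    by apply: Rmult_le_pos; [lra | exact: nodenorm_ge0].
  by apply: h => n; apply: (nodenorm_ge _ _ pos (fun x => v l x - uh x)).
(* The sandwich [uh <= v l.+1 <= v l] at the nodes keeps a vanishing error at zero. *)
have err0 l : err l = 0 -> err l.+1 = 0.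
  move=> el; apply: Rle_antisym; last exact: nodenorm_ge0.
  apply: nodenorm_le => [|n]; first lra.
  have := nodenorm_ge _ _ pos (fun x => v l x - uh x) n; rewrite -/(err l) el.
  have := Rle_abs (v l (pos n) - uh (pos n)); have := decr l n; have := bellman_le_iterates _ _ _ _ _ _ offdiag psi0 barrier _ _ pv _ buh l.+1 n.
  by move=> /= ? ? ? ?; rewrite Rabs_pos_eq; lra.
(* If [err l = 0], the numerator vanishes as well, so the quotient is [0]. *)
exists (fun l => err l.+1 / err l); split=> [eps eps0|l].
  (* Half of [eps] turns the non-strict bound into the strict one required. *)
  have [|l0 h] := super (eps / 2); first lra.
  exists l0 => l /h{}h; case: (Req_dec (err l) 0) => [el|el].
    by rewrite (err0 l el) /Rdiv Rmult_0_l Rabs_R0.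
  have e0 : 0 < err l by have : 0 <= err l := nodenorm_ge0 _ _ _ _; lra.
  rewrite Rabs_pos_eq; last by apply: Rle_mult_inv_pos => //; apply: nodenorm_ge0.
  apply: Rle_lt_trans (_ : eps / 2 < _); last lra.
  apply: (Rmult_le_reg_r (err l)) => //.
  by rewrite /Rdiv Rmult_assoc Rinv_l // Rmult_1_r.
rewrite -/(err l) -/(err l.+1); case: (Req_dec (err l) 0) => [el|el].
  by rewrite (err0 l el) el; lra.
by apply: Req_le; field.
Qed.
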